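(* For every polynomial $p(\cdot)$ there is a lifted-graphic matroid $M$ with the following property: for every set $\mathcal{A}$ of subsets of $E(M)$ with $|\mathcal{A}|\leq p(|E(M)|)$ there is a quasi-graphic matroid $M'$ that is not lifted-graphic, such that $E(M')=E(M)$ and $r_{M'}(A)=r_M(A)$ for each $A\in\mathcal{A}$.
   Context: All matroids are finite. For a graph $G$ and a vertex $v$, $\mathrm{loops}_G(v)$ denotes the set of loop-edges of $G$ at $v$, and $E(G-v)$ is the set of edges of $G$ not incident with $v$. A graph $G$ is a framework for a matroid $M$ if (1) $E(G)=E(M)$; (2) $r_M(E(H))\leq |V(H)|$ for each component $H$ of $G$; and (3) for each vertex $v$ of $G$, $\mathrm{cl}_M(E(G-v))\subseteq E(G-v)\cup \mathrm{loops}_G(v)$. A matroid is quasi-graphic if it has a framework. A matroid $M$ is lifted-graphic if there is a matroid $N$ and an element $e\in E(N)$ such that $N\backslash e=M$ and $N/e$ is graphic. *)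

(* Defs.v *)
From mathcomp Require Import all_boot.


Set Implicit Arguments.
Unset Strict Implicit.
Unset Printing Implicit Defensive.

(* The ground set E(M) is the whole finite type E. *)
Record matroid (E : finType) := Matroid {
  rk : {set E} -> nat;
  rk_card : forall A, rk A <= #|A|;
  rk_mono : forall A B : {set E}, A \subset B -> rk A <= rk B;
  rk_submod : forall A B, rk (A :|: B) + rk (A :&: B) <= rk A + rk B }.

Definition closure_of (E : finType) (M : matroid E) (A : {set E}) : {set E} :=
  [set e | rk M (e |: A) == rk M A].

Definition indep (E : finType) (M : matroid E) (A : {set E}) : bool :=
  rk M A == #|A|.

Definition circuit (E : finType) (M : matroid E) (C : {set E}) : Prop :=
  ~~ indep M C /\ (forall A : {set E}, A \proper C -> indep M A).

(* Matroids with a distinguished element e are taken on option E, e being None,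
   so that N \ e and N / e are both matroids on E. *)
Section SingleElementMinors.
Variables (E : finType) (N : matroid (option E)).

Let del_rk (A : {set E}) := rk N (Some @: A).
Let con_rk (A : {set E}) := rk N (None |: Some @: A) - rk N [set None].

Fact del_card A : del_rk A <= #|A|.
Proof. by rewrite (leq_trans (rk_card N _)) // leq_imset_card. Qed.

Fact del_mono (A B : {set E}) : A \subset B -> del_rk A <= del_rk B.
Proof. by move=> sAB; apply/rk_mono/imsetS. Qed.

Fact SomeI (A B : {set E}) :
  Some @: (A :&: B) = (Some @: A) :&: (Some @: B).
Proof. by apply: imsetI => x y _ _ []. Qed.

Fact del_submod A B :
  del_rk (A :|: B) + del_rk (A :&: B) <= del_rk A + del_rk B.
Proof. by rewrite /del_rk imsetU SomeI rk_submod. Qed.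

Fact con_card A : con_rk A <= #|A|.
Proof.
rewrite /con_rk leq_subLR; apply: leq_trans (leq_add (leqnn _) (del_card A)).
exact: leq_trans (leq_addr _ _) (rk_submod N _ _).
Qed.

Fact con_mono (A B : {set E}) : A \subset B -> con_rk A <= con_rk B.
Proof. by move=> sAB; apply/leq_sub2r/rk_mono/setUS/imsetS. Qed.

Fact con_submod A B :
  con_rk (A :|: B) + con_rk (A :&: B) <= con_rk A + con_rk B.
Proof.
have le1 (X : {set E}) : rk N [set None] <= rk N (None |: Some @: X).
  by apply: rk_mono; apply: subsetUl.
set r := rk N [set None] in le1; rewrite -(leq_add2r (r + r)).
rewrite ![_ + _ + (r + r)]addnACA /con_rk !subnK ?le1 //.
by rewrite imsetU SomeI setUUr setUIr rk_submod.
Qed.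

Definition delete_None : matroid E := Matroid del_card del_mono del_submod.
Definition contract_None : matroid E := Matroid con_card con_mono con_submod.

End SingleElementMinors.

(* Multigraphs with loops: an edge has one end (a loop) or two. *)
Record graph (V E : finType) := Graph {
  ends : E -> {set V};
  ends_card : forall e, 1 <= #|ends e| <= 2 }.

Section Graphs.
Variables (V E : finType) (G : graph V E).

Definition loops (v : V) : {set E} := [set e | ends G e == [set v]].

Definition edges_minus (v : V) : {set E} := [set e | v \notin ends G e].

Definition adj : rel V := [rel u v | [exists e, ends G e == [set u; v]]].

(* Vertex sets of the components of G. *)
Definition components : {set {set V}} :=
  [set [set w | connect adj v w] | v in V].

Definition edges_in (W : {set V}) : {set E} := [set e | ends G e \subset W].

(* X is the edge set of a cycle of G: the cycle has k+1 vertices v_0, ..., v_k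
   and k+1 edges; a loop (k = 0) and a pair of parallel edges (k = 1) count. *)
Definition cycle_edges (X : {set E}) : Prop :=
  exists (k : nat) (v : 'I_k.+1 -> V) (e : 'I_k.+1 -> E),
    [/\ injective v, injective e,
        forall i, ends G (e i) = [set v i; v (ordS i)]
      & X = [set e i | i : 'I_k.+1]].

End Graphs.

Definition graphic (E : finType) (M : matroid E) : Prop :=
  exists (V : finType) (G : graph V E),
    forall C : {set E}, circuit M C <-> cycle_edges G C.

Definition framework (V E : finType) (G : graph V E) (M : matroid E) : Prop :=
  (forall W : {set V}, W \in components G -> rk M (edges_in G W) <= #|W|) /\
  (forall v : V,
     closure_of M (edges_minus G v) \subset edges_minus G v :|: loops G v).

Definition quasi_graphic (E : finType) (M : matroid E) : Prop :=
  exists (V : finType) (G : graph V E), framework G M.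

Definition lifted_graphic (E : finType) (M : matroid E) : Prop :=
  exists N : matroid (option E),
    rk (delete_None N) =1 rk M /\ graphic (contract_None N).

(* Main.v *)
(* The lifted-graphic matroid [M] is the free lift, with rank
   [min (|X|, r_G X + 1)], of the cycle matroid of a cyclic ladder [G] with
   vertices [(i, a)], [i] modulo [n], [a] a bit: consecutive layers are joined
   completely and [(i, false)], [(i, true)] are joined by four parallel rungs.
   Each [s : 'I_n -> bool] splits [V(G)] into two disjoint induced cycles, whose
   union is a circuit-hyperplane of [M]; this gives [2^(n-1)] of them on [8n]
   elements, so for large [n] one of them, [X], is not in the queried family.
   Relaxing [X] changes only the rank of [X], and [G] remains a framework.
   If the relaxation were [N \ e] with [N / e] graphic, then [e] would be spanned
   in [N] by the four rungs of each layer (a line U_{2,4} is not graphic), hence,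
   by modularity, by each of the two cycles of [X]. After the relaxation these
   are skew, so [e] would be a loop and [N \ e] = [N / e] graphic, which the
   rungs forbid. *)
Require Import Defs.
From mathcomp Require Import all_boot all_order all_algebra.
From mathcomp Require Import reals.
Import Order.TTheory GRing.Theory Num.Theory.

Set Implicit Arguments.
Unset Strict Implicit.
Unset Printing Implicit Defensive.

(** * Cycle matroids of graphs *)

Section CycleMatroid.
Local Open Scope ring_scope.
Variables (V E : finType) (G : graph V E).
Implicit Types (X Y A B : {set E}) (S W : {set V}) (e f : E) (u v w : V).

Definition vertex_vec v : {ffun V -> ('F_2)^o} := [ffun w => (w == v)%:R].

(** Over F_2 no orientation of the edges is needed; the test on the number of ends sends a loop to
    0, so that it has rank 0. *)
Definition boundary e : {ffun V -> ('F_2)^o} :=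
  [ffun w => ((#|ends G e| == 2%N) && (w \in ends G e))%:R].

Definition boundary_span X : {vspace {ffun V -> ('F_2)^o}} :=
  (\sum_(e in X) <[boundary e]>)%VS.

(** The cycle-matroid rank, taken as a dimension over F_2: submodularity then comes from the
    dimension formula for sums and intersections of subspaces. *)
Definition grk X : nat := \dim (boundary_span X).

Lemma F2_addss (k : 'F_2) : k + k = 0.
Proof. exact: (addrr_pchar2 (pchar_Fp (isT : prime 2))). Qed.

Lemma F2_addxx (x : {ffun V -> ('F_2)^o}) : x + x = 0.
Proof.
by apply/ffunP => w; rewrite !ffunE F2_addss.
Qed.

Lemma ends_pair e : exists u v, ends G e = [set u; v].
Proof.
have /andP[pos] := ends_card G e.
rewrite leq_eqVlt => /orP[/cards2P[u [v [_ ->]]]|]; first by exists u, v.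
rewrite ltnS leq_eqVlt ltnNge pos orbF => /cards1P[u ->].
by exists u, u; rewrite setUid.
Qed.

Lemma boundaryE e u v :
  ends G e = [set u; v] -> boundary e = vertex_vec u + vertex_vec v.
Proof.
move=> Ee; apply/ffunP => w; rewrite !ffunE Ee cards2 !inE.
have [->|neq] := eqVneq u v.
  by rewrite F2_addss.
rewrite eqxx /=; have [->|] := eqVneq w u; last by rewrite add0r.
by rewrite (negPf neq) addr0.
Qed.

Lemma boundary_span_mem X e : e \in X -> boundary e \in boundary_span X.
Proof. by move=> eX; rewrite memvE; apply: (sumv_sup e). Qed.

Lemma boundary_span_sub X (U : {vspace {ffun V -> ('F_2)^o}}) :
  (forall e, e \in X -> boundary e \in U) -> (boundary_span X <= U)%VS.
Proof. by move=> XU; apply/subv_sumP => e /XU; rewrite memvE. Qed.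

Lemma boundary_spanS A B : A \subset B -> (boundary_span A <= boundary_span B)%VS.
Proof.
by move=> /subsetP sAB; apply: boundary_span_sub => e /sAB; apply: boundary_span_mem.
Qed.

Lemma boundary_spanU A B :
  boundary_span (A :|: B) = (boundary_span A + boundary_span B)%VS.
Proof.
apply/eqP; rewrite eqEsubv subv_add !boundary_spanS ?subsetUl ?subsetUr ?andbT //.
apply: boundary_span_sub => e /setUP[] /boundary_span_mem; rewrite !memvE => le.
  by apply: subv_trans le _; apply: addvSl.
by apply: subv_trans le _; apply: addvSr.
Qed.

Lemma boundary_span1 e : boundary_span [set e] = <[boundary e]>%VS.
Proof. by rewrite /boundary_span big_set1. Qed.

Fact grk_card A : (grk A <= #|A|)%N.
Proof.
apply: (leq_trans (dimv_leq_sum _ _ _)); rewrite -sum1_card.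
by apply: leq_sum => e _; rewrite dim_vline leq_b1.
Qed.

Fact grk_mono A B : A \subset B -> (grk A <= grk B)%N.
Proof. by move=> sAB; apply/dimvS/boundary_spanS. Qed.

Fact grk_submod A B : (grk (A :|: B) + grk (A :&: B) <= grk A + grk B)%N.
Proof.
rewrite /grk boundary_spanU -[leqRHS]dimv_sum_cap leq_add2l dimvS // subv_cap.
by rewrite !boundary_spanS ?subsetIl ?subsetIr.
Qed.

Definition cycle_matroid : matroid E := Matroid grk_card grk_mono grk_submod.

(** * Cuts and rank bounds *)

Lemma sum_vertex_vec S v : \sum_(w in S) vertex_vec v w = (v \in S)%:R.
Proof.
have [vS|vS] := boolP (v \in S).
  rewrite (bigD1 v) //= ffunE eqxx big1 ?addr0 // => w /andP[_ /negPf nwv].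
  by rewrite ffunE nwv.
apply: big1 => w wS; rewrite ffunE; case: eqVneq => // wv.
by rewrite wv (negPf vS) in wS.
Qed.

Lemma sum_boundary S e u v : ends G e = [set u; v] ->
  \sum_(w in S) boundary e w = ((u \in S) (+) (v \in S))%:R.
Proof.
move/boundaryE=> ->; under eq_bigr do rewrite ffunE.
by rewrite big_split /= !sum_vertex_vec; do 2!case: (_ \in S); apply/val_inj.
Qed.

(* A cut separating the ends of [e] is a linear functional that is nonzero on
   the boundary of [e] and vanishes on the boundaries of the other edges. *)
Lemma grk_cut S X e u v : ends G e = [set u; v] -> u \in S -> v \notin S ->
  (forall f, f \in X -> (ends G f \subset S) || (ends G f \subset ~: S)) ->
  grk (e |: X) = (grk X).+1.
Proof.
move=> Ee uS vS nX.
pose U := boundary_span X.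
have nU x : x \in U -> \sum_(w in S) x w = 0.
  move=> /memv_sumP[y yP ->]; under eq_bigr do rewrite sum_ffunE.
  rewrite exchange_big big1 //= => f fX; have /vlineP[k ->] := yP f fX.
  under eq_bigr do rewrite ffunE.
  rewrite -mulr_sumr; have [a [b Ef]] := ends_pair f; rewrite (sum_boundary _ Ef).
  have := nX f fX; rewrite Ef !subUset !sub1set !inE.
  by do 2!case: (_ \in S); rewrite ?mulr0.
have dimE : \dim <[boundary e]> = 1%N.
  rewrite dim_vline; case: eqP => // e0; have := sum_boundary S Ee.
  rewrite e0 uS (negPf vS) big1 // => w _; by rewrite ffunE.
have cap0 : (<[boundary e]> :&: U)%VS = 0%VS.
  apply/eqP; rewrite -subv0; apply/subvP => x /memv_capP[/vlineP[k ->] /nU].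
  under eq_bigr do rewrite ffunE.
  rewrite -mulr_sumr (sum_boundary _ Ee) uS (negPf vS) mulr1 => ->.
  by rewrite scale0r mem0v.
have := dimv_sum_cap <[boundary e]> U.
by rewrite cap0 dimv0 addn0 dimE add1n -boundary_span1 -boundary_spanU.
Qed.

(** The two spans are supported on [S] and on its complement, hence meet in 0. *)
Lemma grk_disjoint S X Y :
    (forall f, f \in X -> ends G f \subset S) ->
    (forall f, f \in Y -> ends G f \subset ~: S) ->
  grk (X :|: Y) = (grk X + grk Y)%N.
Proof.
move=> XS YS.
have supp (Z : {set E}) (T : {set V}) x : (forall f, f \in Z -> ends G f \subset T) ->
    x \in boundary_span Z -> forall w, w \notin T -> x w = 0.
  move=> ZT /memv_sumP[y yP ->] w wT; rewrite sum_ffunE big1 // => f fZ.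
  have /vlineP[k ->] := yP f fZ; rewrite !ffunE.
  have /negPf-> : w \notin ends G f by apply: contra wT; apply/subsetP/ZT.
  by rewrite andbF scaler0.
have cap0 : (boundary_span X :&: boundary_span Y)%VS = 0%VS.
  apply/eqP; rewrite -subv0; apply/subvP => x /memv_capP[xX xY].
  rewrite memv0; apply/eqP/ffunP => w; rewrite [RHS]ffunE.
  have [wS|wS] := boolP (w \in S); last exact: supp XS xX _ wS.
  by apply: (supp _ _ _ YS xY); rewrite inE wS.
have := dimv_sum_cap (boundary_span X) (boundary_span Y).
by rewrite cap0 dimv0 addn0 -boundary_spanU.
Qed.

(** In characteristic 2 the boundary a + b equals (a + w) + (b + w), so the [#|W|] - 1 vectors v + w
    with v in [W :\ w] span all boundaries. *)
Lemma grk_edges_in W w : w \in W -> (grk (edges_in G W) < #|W|)%N.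
Proof.
move=> wW; rewrite (cardsD1 w W) wW add1n ltnS.
pose U := (\sum_(v in W :\ w) <[vertex_vec v + vertex_vec w]>)%VS.
have sU v : v \in W -> vertex_vec v + vertex_vec w \in U.
  have [-> _|nvw vW] := eqVneq v w; first by rewrite F2_addxx mem0v.
  by rewrite memvE; apply: (sumv_sup v) => //; rewrite !inE nvw.
apply: (@leq_trans (\dim U)).
  apply/dimvS/boundary_span_sub => e; rewrite inE.
  have [a [b Ee]] := ends_pair e; rewrite Ee subUset !sub1set => /andP[aW bW].
  rewrite (boundaryE Ee).
  have := memvD (sU a aW) (sU b bW).
  by rewrite addrACA F2_addxx addr0.
apply: (leq_trans (dimv_leq_sum _ _ _)); rewrite -sum1_card.
by apply: leq_sum => v _; rewrite dim_vline leq_b1.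
Qed.

(** * Cycles of a graph as circuits of its cycle matroid *)

Lemma sum_boundary_cycle (k : nat) (v : 'I_k.+1 -> V) (e : 'I_k.+1 -> E) :
  (forall i, ends G (e i) = [set v i; v (ordS i)]) ->
  \sum_i boundary (e i) = 0.
Proof.
move=> Ee; under eq_bigr do rewrite (boundaryE (Ee _)).
rewrite big_split /= [X in X + _](reindex_inj (@ordS_inj _)).
exact: F2_addxx.
Qed.

Lemma cycle_edges_neq0 X : cycle_edges G X -> X != set0.
Proof.
by move=> [k [v [e [_ _ _ ->]]]]; apply/set0Pn; exists (e ord0); apply: imset_f.
Qed.

Lemma cycle_edges_sum X : cycle_edges G X -> \sum_(f in X) boundary f = 0.
Proof.
move=> [k [v [e [_ e_inj Ee ->]]]].
by rewrite big_imset /=; [apply: sum_boundary_cycle Ee | move=> i j _ _ /e_inj].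
Qed.

Lemma grk_cycle_edges X : cycle_edges G X -> (grk X < #|X|)%N.
Proof.
move=> cX; have /set0Pn[e eX] := cycle_edges_neq0 cX.
have := cycle_edges_sum cX; rewrite (big_setD1 e eX) /= => /eqP.
rewrite addr_eq0 => /eqP eE.
have -> : grk X = grk (X :\ e).
  congr (\dim _); apply/eqP; rewrite eqEsubv andbC boundary_spanS ?subD1set //=.
  apply: boundary_span_sub => f fX; have [->|nfe] := eqVneq f e.
    by rewrite eE memvN; apply: memv_suml => g gX; apply: boundary_span_mem.
  by apply: boundary_span_mem; rewrite !inE nfe.
by rewrite (cardsD1 e X) eX add1n ltnS grk_card.
Qed.

Lemma ordS_invariant (k : nat) (P : pred 'I_k.+1) (i j : 'I_k.+1) :
  (forall h, P (ordS h) = P h) -> P i = P j.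
Proof.
move=> PS; suff P0 (h : 'I_k.+1) : P h = P ord0 by rewrite !P0.
case: h; elim=> [|h IHh] lt_h; first by congr (P _); apply/val_inj.
rewrite -(IHh (ltnW lt_h)) -[RHS]PS; congr (P _); apply/val_inj => /=.
by rewrite modn_small.
Qed.

(* The parity of the degrees of [Y] at the vertices of the cycle [X] makes
   membership in [Y] pass from each edge of [X] to the next. *)
Lemma cycle_edges_sub X Y :
  cycle_edges G X -> cycle_edges G Y -> Y \subset X -> Y = X.
Proof.
move=> [k [v [e [v_inj e_inj Ee ->]]]] cY sYX.
have Y0 := cycle_edges_sum cY; have /set0Pn[f fY] := cycle_edges_neq0 cY.
have YE : Y = [set e i | i in [pred i | e i \in Y]].
  apply/setP => g; apply/idP/imsetP => [gY|[i iY ->]//].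
  by have /imsetP[i _ gE] := subsetP sYX g gY; exists i; rewrite // inE -gE.
have inv h : (e (ordS h) \in Y) = (e h \in Y).
  have: (\sum_(i | e i \in Y) (vertex_vec (v i) + vertex_vec (v (ordS i))))
          (v (ordS h)) = 0.
    under eq_bigr do rewrite -(boundaryE (Ee _)).
    by rewrite -(big_imset _ (in2W e_inj)) -YE Y0 ffunE.
  rewrite big_split /= ffunE !sum_ffunE.
  have pickE (g : 'I_k.+1 -> 'I_k.+1) (h' : 'I_k.+1) : injective g ->
      \sum_(i | e i \in Y) vertex_vec (v (g i)) (v (g h')) = (e h' \in Y)%:R.
    move=> g_inj; have [hY|hY] := boolP (e h' \in Y).
      rewrite (bigD1 h') //= ffunE eqxx big1 ?addr0 // => i /andP[_ nih].
      by rewrite ffunE (inj_eq v_inj) (inj_eq g_inj) eq_sym (negPf nih).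
    apply: big1 => i iY; rewrite ffunE (inj_eq v_inj) (inj_eq g_inj).
    by case: eqVneq => // hi; rewrite hi iY in hY.
  rewrite (pickE id) // (pickE (@ordS _)); last exact: ordS_inj.
  by do 2!case: (_ \in Y).
have /imsetP[i0 _ fE] := subsetP sYX f fY.
apply/eqP; rewrite eqEsubset sYX; apply/subsetP => _ /imsetP[i _ ->].
by rewrite (@ordS_invariant _ (fun i => e i \in Y) i i0) // -fE.
Qed.

Definition adj_in A : rel V :=
  [rel x y | [exists f in A, ends G f == [set x; y]]].

(** A simple path from [u] to [v] in [A] is closed up by [e]. If [e] is a loop, the path is trivial
    and the cycle has one edge. *)
Lemma connect_cycle A e u v : ends G e = [set u; v] -> e \notin A ->
  connect (adj_in A) u v -> exists2 Y : {set E}, Y \subset e |: A & cycle_edges G Y.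
Proof.
move=> Ee eA /connectP[q qP vE]; move: Ee; rewrite vE {v vE}.
case/shortenP: qP => p pP up _ Ee.
pose k := size p.
pose x i := nth u (u :: p) i.
(* Index [k] carries the closing edge [e]. Below [k] the default of [odflt] is never reached, since
   consecutive vertices of the path are adjacent in [A]. *)
pose F i := if (i < k)%N
  then odflt e [pick g in A | ends G g == [set x i; x i.+1]] else e.
have FP i : (i < k)%N -> F i \in A /\ ends G (F i) = [set x i; x i.+1].
  move=> ik; rewrite /F ik; case: pickP => [g /andP[gA /eqP //]|no].
  have /pathP - /(_ u i ik) /existsP[g] := pP.
  by rewrite no.
have Fk : F k = e by rewrite /F ltnn.
have x_inj i j : (i <= k)%N -> (j <= k)%N -> x i = x j -> i = j.
  by move=> ik jk /eqP; rewrite nth_uniq // => /eqP.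
(* The closing edge is not in [A]. Two equal path edges would put [x i] among [x j], [x j.+1], which
   is impossible for i < j on a simple path. *)
have F_inj i j : (i < j)%N -> (j <= k)%N -> F i <> F j.
  move=> ij; rewrite leq_eqVlt => /predU1P[jk|jk] Fij.
    have [] := FP i; first by rewrite -jk.
    by rewrite Fij jk Fk (negPf eA).
  have [_ Ei] := FP i (ltn_trans ij jk); have [_ Ej] := FP j jk.
  have: x i \in ends G (F j) by rewrite -Fij Ei !inE eqxx.
  have ik : (i <= k)%N by rewrite ltnW // (ltn_trans ij).
  rewrite Ej !inE => /orP[] /eqP /x_inj xij.
    have ijE : i = j by apply: xij; rewrite // ltnW.
    by rewrite ijE ltnn in ij.
  have ijE : i = j.+1 by apply: xij.
  by rewrite ijE ltnNge leqnSn in ij.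
exists [set F i | i : 'I_k.+1].
  apply/subsetP => _ /imsetP[[i ik] _ ->] /=; rewrite !inE.
  move: ik; rewrite ltnS leq_eqVlt => /predU1P[->|/FP[->]].
    by rewrite Fk eqxx.
  by rewrite orbT.
exists k, (fun i => x i), (fun i => F i); split=> //.
- by move=> i j /x_inj ij; apply/val_inj/ij; rewrite -ltnS.
- move=> i j Fij; apply/val_inj; case: (ltngtP i j) => // lt.
    by case: (F_inj _ _ lt); rewrite // -ltnS.
  by case: (F_inj _ _ lt); rewrite // -ltnS.
- case=> i /= ik; move: (ik); rewrite ltnS leq_eqVlt => /predU1P[iE|ltik].
    rewrite iE modnn Fk Ee setUC; congr ([set _; _]).
    by rewrite /x /k -last_nth.
  by have [_ ->] := FP i ltik; rewrite modn_small.
Qed.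

(** Induction on the size: remove an edge [e]. Either the rest is still dependent, or the ends of
    [e] are connected in the rest and [e] closes a cycle. *)
Lemma dependent_cycle X :
  (grk X < #|X|)%N -> exists2 Y : {set E}, Y \subset X & cycle_edges G Y.
Proof.
move: {2}#|X| (leqnn #|X|) => n; elim: n X => [|n IHn] X.
  by rewrite leqn0 => /eqP ->.
move=> Xn dX; have [X0|/set0Pn[e eX]] := eqVneq X set0.
  by rewrite X0 cards0 in dX.
have cardX := cardsD1 e X; rewrite eX add1n in cardX.
have [dXe|] := ltnP (grk (X :\ e)) #|X :\ e|.
  have [|Y sY cY] := IHn (X :\ e) _ dXe; first by rewrite -ltnS -cardX.
  by exists Y => //; apply: subset_trans sY (subD1set _ _).
move=> iXe; have [u [v Ee]] := ends_pair e.
have [c|nc] := boolP (connect (adj_in (X :\ e)) u v).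
  have [|Y] := connect_cycle Ee _ c; first by rewrite !inE eqxx.
  by rewrite setD1K //; exists Y.
(* Otherwise [e] is the only edge of [X] leaving the component [S] of [u], so it raises the rank of
   the independent set [X :\ e], and [X] would be independent. *)
pose S := [set w | connect (adj_in (X :\ e)) u w].
have: grk (e |: X :\ e) = (grk (X :\ e)).+1.
  apply: (grk_cut (S := S) Ee); rewrite ?inE ?connect0 // => f fX.
  have [a [b Ef]] := ends_pair f; rewrite Ef !subUset !sub1set !inE.
  have ab : adj_in (X :\ e) a b by apply/existsP; exists f; rewrite fX Ef /=.
  have ba : adj_in (X :\ e) b a.
    by apply/existsP; exists f; rewrite fX Ef setUC /=.
  have -> : connect (adj_in (X :\ e)) u a = connect (adj_in (X :\ e)) u b.
    by apply/idP/idP => /connect_trans -> //; apply: connect1.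
  by case: (connect _ u b).
by rewrite setD1K // => gE; move: dX; rewrite gE cardX ltnS ltnNge iXe.
Qed.

(** Every dependent set contains a cycle, cycles are dependent, and no cycle properly contains
    another. *)
Lemma circuit_cycle_matroid X :
  circuit cycle_matroid X <-> cycle_edges G X.
Proof.
have depE A : ~~ indep cycle_matroid A = (grk A < #|A|)%N.
  by rewrite /indep /= ltn_neqAle grk_card andbT.
split=> [[dX minX]|cX].
  move: dX; rewrite depE => /dependent_cycle[Y sYX cY].
  move: sYX; rewrite subEproper => /predU1P[<-//|/minX].
  by have := grk_cycle_edges cY; rewrite -depE => /negPf->.
split=> [|A pA]; first by rewrite depE grk_cycle_edges.
apply: contraT; rewrite depE => /dependent_cycle[Y sYA cY].
have YX := cycle_edges_sub cX cY (subset_trans sYA (proper_sub pA)).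
by rewrite properE -YX sYA andbF in pA.
Qed.

End CycleMatroid.

(** * Free lifts, relaxations and non-lifted-graphic matroids *)

Section Circuits.
Variables (E : finType) (M : matroid E).
Implicit Types A B C : {set E}.

Lemma rk_setU A B : rk M (A :|: B) <= rk M A + rk M B.
Proof. exact: leq_trans (leq_addr _ _) (rk_submod M A B). Qed.

Lemma indepS A B : A \subset B -> indep M B -> indep M A.
Proof.
move=> sAB /eqP iB; rewrite /indep eqn_leq rk_card /=.
rewrite -(leq_add2r #|B :\: A|).
have <- : #|B| = #|A| + #|B :\: A| by rewrite -(cardsID A B) (setIidPr sAB).
rewrite -iB -{1}(setID B A) (setIidPr sAB).
by apply: leq_trans (rk_setU _ _) _; rewrite leq_add2l rk_card.
Qed.

Lemma rk_circuit_sub C A : circuit M C -> A \subset C -> #|A| <= (rk M A).+1.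
Proof.
move=> [_ minC] sAC; have [->|/set0Pn[e eA]] := eqVneq A set0.
  by rewrite cards0.
rewrite (cardsD1 e A) eA add1n ltnS.
have /minC/eqP<- : A :\ e \proper C by apply: proper_sub_trans sAC; apply: properD1.
by apply/rk_mono/subD1set.
Qed.

Lemma rk_circuit C : circuit M C -> (rk M C).+1 = #|C|.
Proof.
move=> cC; apply/eqP; rewrite eqn_leq (rk_circuit_sub cC) // andbT.
by have [dC _] := cC; rewrite ltn_neqAle dC rk_card.
Qed.

End Circuits.

(** * Free elementary lifts *)

Section FreeLift.
Variables (E : finType) (M : matroid E).
Implicit Types A B : {set E}.

(** The independent sets of this matroid are the sets of nullity at most one in [M]. *)
Definition free_lift_rk A := minn #|A| (rk M A).+1.

Fact free_lift_card A : free_lift_rk A <= #|A|.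
Proof. exact: geq_minl. Qed.

Fact free_lift_mono A B : A \subset B -> free_lift_rk A <= free_lift_rk B.
Proof.
move=> sAB; rewrite leq_min !geq_min subset_leq_card //= ltnS.
by rewrite rk_mono ?orbT.
Qed.

Fact free_lift_submod A B :
  free_lift_rk (A :|: B) + free_lift_rk (A :&: B)
    <= free_lift_rk A + free_lift_rk B.
Proof.
(* The mixed case, where the minimum is the cardinality for one set and the rank term for the other:
   adding [X :\: Y] to [Y] raises the rank by at most its size. *)
have half X Y : free_lift_rk (X :|: Y) + free_lift_rk (X :&: Y)
    <= #|X| + (rk M Y).+1.
  apply: leq_trans (leq_add (geq_minr _ _) (geq_minl _ _)) _.
  have -> : X :|: Y = (X :\: Y) :|: Y.
    by apply/setP => x; rewrite !inE; case: (x \in Y); rewrite ?orbT ?orbF.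
  rewrite addSn addnS ltnS addnC -(cardsID Y X) -addnA leq_add2l.
  by apply: leq_trans (rk_setU _ _ _) _; rewrite leq_add2r rk_card.
rewrite {3 4}/free_lift_rk; case: (leqP #|A|) => cA; case: (leqP #|B|) => cB.
- by rewrite -cardsUI leq_add ?geq_minl.
- exact: half.
- by rewrite setUC setIC [leqRHS]addnC; exact: half.
- apply: leq_trans (leq_add (geq_minr _ _) (geq_minr _ _)) _.
  by rewrite !addSn !addnS !ltnS rk_submod.
Qed.

Definition free_lift : matroid E :=
  Matroid free_lift_card free_lift_mono free_lift_submod.

End FreeLift.

Section AddLoop.
Variables (E : finType) (M : matroid E).
Implicit Types A B : {set option E}.

Definition add_loop_rk A := rk M (Some @^-1: A).

Fact add_loop_card A : add_loop_rk A <= #|A|.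
Proof.
apply: leq_trans (rk_card _ _) _.
rewrite -(card_imset _ Some_inj); apply: subset_leq_card.
by apply/subsetP => _ /imsetP[x + ->]; rewrite inE.
Qed.

Fact add_loop_mono A B : A \subset B -> add_loop_rk A <= add_loop_rk B.
Proof. by move=> sAB; apply/rk_mono/preimsetS. Qed.

Fact add_loop_submod A B :
  add_loop_rk (A :|: B) + add_loop_rk (A :&: B) <= add_loop_rk A + add_loop_rk B.
Proof. by rewrite /add_loop_rk preimsetU preimsetI rk_submod. Qed.

Definition add_loop : matroid (option E) :=
  Matroid add_loop_card add_loop_mono add_loop_submod.

End AddLoop.

Lemma circuit_eq_rk (E : finType) (M M' : matroid E) (C : {set E}) :
  rk M =1 rk M' -> circuit M C <-> circuit M' C.
Proof.
move=> eqM; rewrite /circuit /indep eqM.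
by split=> -[dC minC]; split=> // A /minC; rewrite eqM.
Qed.

Lemma preimset_Some (E : finType) (A : {set E}) : Some @^-1: (Some @: A) = A.
Proof. by apply/setP => x; rewrite inE mem_imset //; apply: Some_inj. Qed.

Lemma None_Some (E : finType) (A : {set E}) : None \notin Some @: A.
Proof. by apply/imsetP => -[]. Qed.

(** The witness adds [None] as a loop and then lifts freely. The lift gives [None] rank 1, and
    contracting it subtracts the extra 1 again, which leaves [M]. *)
Lemma free_lift_lifted_graphic (E : finType) (M : matroid E) :
  graphic M -> lifted_graphic (free_lift M).
Proof.
move=> [V [G MG]]; exists (free_lift (add_loop M)); split.
  move=> A /=; rewrite /free_lift_rk /= /add_loop_rk preimset_Some.
  by rewrite card_imset //; apply: Some_inj.
exists V, G => C; rewrite -MG; apply: circuit_eq_rk => A /=.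
have pre0 : Some @^-1: [set None] = set0 :> {set E}.
  by apply/setP => x; rewrite !inE.
have rk0 : rk M set0 = 0 by apply/eqP; rewrite -leqn0 -(cards0 E) rk_card.
rewrite /free_lift_rk /= /add_loop_rk preimsetU pre0 set0U preimset_Some.
rewrite cards1 rk0 cardsU1 None_Some card_imset; last exact: Some_inj.
by rewrite minnn add1n minnSS subn1 /=; apply/minn_idPr; apply: rk_card.
Qed.

(** * Relaxation of a circuit-hyperplane *)

Section Relaxation.
Variables (E : finType) (M : matroid E) (H : {set E}).
Hypothesis dH : rk M H < #|H|.
Hypothesis minH : forall A : {set E}, A \proper H -> rk M A = #|A|.
Hypothesis maxH : forall A : {set E}, H \proper A -> rk M A = (rk M H).+1.
Implicit Types A B : {set E}.

(** By [dH] and [minH] the set [H] is a circuit, of rank [#|H|] - 1; the added 1 makes it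
    independent. *)
Definition relax_rk A := rk M A + (A == H).

Fact relax_card A : relax_rk A <= #|A|.
Proof.
by rewrite /relax_rk; case: eqP => [->|_]; rewrite ?addn1 ?addn0 ?rk_card.
Qed.

Fact relax_mono A B : A \subset B -> relax_rk A <= relax_rk B.
Proof.
rewrite /relax_rk; have [->|nAH sAB] := eqVneq A H; last first.
  by rewrite addn0 (leq_trans (rk_mono _ sAB)) ?leq_addr.
rewrite subEproper => /predU1P[->|pHB]; first by rewrite eqxx.
by rewrite (maxH pHB) addn1 leq_addr.
Qed.

(** When neither set is [H], the left side grows only if the union or the intersection is [H]. In
    the first case [A] and [B] are independent proper subsets of [H] and cardinalities suffice. In
    the second, [A], [B] and their union all have rank one above that of [H], which leaves room for
    the extra 1. *)
Fact relax_submod A B :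
  relax_rk (A :|: B) + relax_rk (A :&: B) <= relax_rk A + relax_rk B.
Proof.
wlog nAH : A B / A != H.
  move=> gen; have [AH|] := eqVneq A H; last exact: gen.
  have [BH|] := eqVneq B H; last first.
    by rewrite setUC setIC [leqRHS]addnC; exact: gen.
  by rewrite AH BH setUid setIid.
have [->|nBH] := eqVneq B H.
  have [sAH|nsAH] := boolP (A \subset H).
    by rewrite (setUidPr sAH) (setIidPl sAH) addnC.
  rewrite {1 2}/relax_rk.
  have -> : (A :|: H == H) = false.
    by apply/negbTE; apply: contra nsAH => /eqP <-; apply: subsetUl.
  have [AIH|_] := eqVneq (A :&: H) H.
    have sHA : H \subset A by rewrite -AIH subsetIl.
    by rewrite (setUidPl sHA) (setIidPr sHA) /relax_rk (negPf nAH) eqxx addn0.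
  rewrite !addn0 /relax_rk (negPf nAH) addn0 addnA.
  by apply: leq_trans (rk_submod _ _ _) _; apply: leq_addr.
have [UH|nUH] := eqVneq (A :|: B) H.
  have pA : A \proper H by rewrite properEneq nAH -UH subsetUl.
  have pB : B \proper H by rewrite properEneq nBH -UH subsetUr.
  rewrite {3 4}/relax_rk (negPf nAH) (negPf nBH) !addn0 !minH //.
  by rewrite -cardsUI leq_add ?relax_card.
rewrite /relax_rk (negPf nAH) (negPf nBH) (negPf nUH) !addn0.
have [IH|_] := eqVneq (A :&: B) H; last by rewrite addn0 rk_submod.
have pA : H \proper A by rewrite properEneq eq_sym nAH -IH subsetIl.
have pB : H \proper B by rewrite properEneq eq_sym nBH -IH subsetIr.
have pU : H \proper A :|: B by apply: proper_sub_trans pA (subsetUl _ _).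
by rewrite (maxH pA) (maxH pB) (maxH pU) IH addn1.
Qed.

Definition relax : matroid E := Matroid relax_card relax_mono relax_submod.

End Relaxation.

(** * An obstruction to being lifted-graphic *)

Section NotLifted.
Local Open Scope ring_scope.

(** The restriction of [M] to [L] is U_{2,4}, which is not binary. *)
Definition four_point_line (E : finType) (M : matroid E) (L : {set E}) : Prop :=
  exists a b c d : E, [/\ uniq [:: a; b; c; d], L = [set a; b; c; d]
    & forall A : {set E}, A \subset L -> rk M A = minn #|A| 2].

(* In a binary matroid the third element of a triangle is determined, up to
   parallelism, by the other two. *)
Lemma four_point_line_not_graphic (E : finType) (M : matroid E) (L : {set E}) :
  four_point_line M L -> ~ graphic M.
Proof.
move=> [a [b [c [d [Uabcd LE rkL]]]]] [V [G MG]].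
have triangle x : x \in L -> x != a -> x != b ->
    boundary G x = boundary G a + boundary G b.
  move=> xL xa xb.
  have ab : a != b by move: Uabcd; rewrite /= !inE !negb_or => /andP[/and3P[]].
  have cT : #|[set a; b; x]| = 3%N.
    rewrite setUC cardsU1 !inE negb_or xa xb cards2 ab //.
  have sT : [set a; b; x] \subset L.
    by rewrite !subUset !sub1set xL LE !inE !eqxx ?orbT.
  have /MG/cycle_edges_sum : circuit M [set a; b; x].
    split=> [|A pA]; first by rewrite /indep rkL // cT.
    have := proper_card pA; rewrite cT ltnS => cA.
    by rewrite /indep rkL ?(minn_idPl cA) // (subset_trans (proper_sub pA)).
  rewrite setUC big_setU1 ?inE ?negb_or ?xa //= big_setU1 ?inE //= big_set1.
  move=> sum0; rewrite -[RHS]add0r -sum0 -addrA F2_addxx addr0 //.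
have [cL dL] : c \in L /\ d \in L by rewrite LE !inE !eqxx ?orbT.
move: (Uabcd); rewrite /= !inE !negb_or !andbT.
move=> /and3P[/and3P[ab ac ad] /andP[bc bd] cd].
have cdE : boundary G c = boundary G d.
  by rewrite (triangle c) ?(triangle d) // eq_sym.
have /dependent_cycle[Y sY /MG[/negP dY _]] : (grk G [set c; d] < #|[set c; d]|)%N.
  rewrite cards2 cd ltnS /grk /boundary_span big_setU1 ?inE //= big_set1 cdE.
  by rewrite addvv dim_vline leq_b1.
apply: dY; apply: indepS sY _; rewrite /indep rkL ?cards2 ?cd //.
by rewrite subUset !sub1set cL.
Qed.

Local Open Scope nat_scope.

(* If [L] did not span the new element [None], contracting [None] would not
   change the restriction to [L]. *)
Lemma four_point_line_spans (E : finType) (N : matroid (option E)) (L : {set E}) :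
    graphic (contract_None N) -> four_point_line (delete_None N) L ->
  rk N [set None] = 1 /\ rk N (None |: Some @: L) = rk N (Some @: L).
Proof.
move=> gN [a [b [c [d [Uabcd LE rkL]]]]].
have rkN : rk N [set None] <= 1 by rewrite -(cards1 (@None E)) rk_card.
have leN A : rk N (None |: Some @: A) <= rk N [set None] + rk N (Some @: A).
  exact: rk_setU.
have [span|nspan] :=
    boolP ((rk N [set None] == 1) && (rk N (None |: Some @: L) == rk N (Some @: L))).
  by case/andP: span => /eqP-> /eqP->.
case: (@four_point_line_not_graphic _ (contract_None N) L) => //.
exists a, b, c, d; split=> // A sAL; rewrite -rkL //=.
suff -> : rk N (None |: Some @: A) = rk N [set None] + rk N (Some @: A).
  by rewrite addKn.
apply/eqP; rewrite eqn_leq leN /=.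
have [rk0|rk1] := posnP (rk N [set None]).
  by rewrite rk0 add0n rk_mono // subsetUr.
have rkN1 : rk N [set None] = 1 by apply/eqP; rewrite eqn_leq rkN.
rewrite rkN1 add1n; move: nspan; rewrite rkN1 /= => nspan.
have ltL : rk N (Some @: L) < rk N (None |: Some @: L).
  by rewrite ltn_neqAle eq_sym nspan rk_mono // subsetUr.
(* Since [A] lies in [L] and [None] raises the rank of [L], submodularity makes it raise the rank of
   [A] as well. *)
have := rk_submod N (None |: Some @: A) (Some @: L).
rewrite -setUA -imsetU (setUidPr sAL) setIUl -SomeI (setIidPl sAL).
have -> : [set None] :&: Some @: L = set0.
  by apply/setP => x; rewrite !inE; case: eqP => // ->; rewrite (negPf (None_Some L)).
rewrite set0U => le; rewrite -(leq_add2r (rk N (Some @: L))).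
by apply: leq_trans le; rewrite addSnnS addnC leq_add2r.
Qed.

Section SpanNone.
Variables (E : finType) (N : matroid (option E)).
Implicit Types X Y A L C : {set E}.

(** Submodularity for [X] and [Y] with [None] added to both. If [X] and [Y] form a modular pair
    meeting in [A], it shows that [A] spans [None] too. *)
Lemma rk_None_meet X Y A :
    rk N (None |: Some @: X) = rk N (Some @: X) ->
    rk N (None |: Some @: Y) = rk N (Some @: Y) ->
    A \subset X -> A \subset Y ->
  rk N (Some @: (X :|: Y)) + rk N (None |: Some @: A)
    <= rk N (Some @: X) + rk N (Some @: Y).
Proof.
move=> <- <- sAX sAY; apply: leq_trans (rk_submod _ _ _).
rewrite imsetU leq_add // rk_mono //.
  by rewrite setUSS ?subsetUr.
by rewrite subsetI !setUS ?imsetS.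
Qed.

Lemma rk_None_mono X Y : X \subset Y ->
  rk N (None |: Some @: X) = rk N (Some @: X) ->
  rk N (None |: Some @: Y) = rk N (Some @: Y).
Proof.
move=> sXY spanX; apply/eqP; rewrite eqn_leq andbC rk_mono ?subsetUr //=.
have := rk_submod N (None |: Some @: X) (Some @: Y).
rewrite -setUA -imsetU (setUidPr sXY) spanX => le.
rewrite -(leq_add2r (rk N (Some @: X))) [leqRHS]addnC.
apply: leq_trans le; rewrite leq_add2l rk_mono //.
by rewrite subsetI subsetUr imsetS.
Qed.

End SpanNone.

(** Both lines span [None], hence so do [C1 :|: L1] and [C1 :|: L2]; modularity passes this down to
    [C1], and likewise to [C2]. *)
Lemma skew_not_lifted_graphic (E : finType) (M : matroid E)
    (L1 L2 C1 C2 : {set E}) :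
    four_point_line M L1 -> four_point_line M L2 ->
    rk M (C1 :|: L1) + rk M (C1 :|: L2) <= rk M (C1 :|: L1 :|: L2) + rk M C1 ->
    rk M (C2 :|: L1) + rk M (C2 :|: L2) <= rk M (C2 :|: L1 :|: L2) + rk M C2 ->
    rk M C1 + rk M C2 <= rk M (C1 :|: C2) ->
  ~ lifted_graphic M.
Proof.
move=> line1 line2 mod1 mod2 skew [N [NM gN]].
have lineN (L : {set E}) : four_point_line M L -> four_point_line (delete_None N) L.
  move=> [a [b [c [d [U LE rkL]]]]]; exists a, b, c, d; split=> // A sAL.
  by rewrite NM rkL.
have [rkN span1] := four_point_line_spans gN (lineN _ line1).
have [_ span2] := four_point_line_spans gN (lineN _ line2).
have NME (A : {set E}) : rk N (Some @: A) = rk M A by exact: NM.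
have spanC (C : {set E}) : rk M (C :|: L1) + rk M (C :|: L2)
    <= rk M (C :|: L1 :|: L2) + rk M C ->
    rk N (None |: Some @: C) = rk N (Some @: C).
  move=> modC; apply/eqP; rewrite eqn_leq andbC rk_mono ?subsetUr //=.
  have := rk_None_meet (rk_None_mono (subsetUr C L1) span1)
    (rk_None_mono (subsetUr C L2) span2) (subsetUl C L1) (subsetUl C L2).
  rewrite setUACA setUid setUA !NME => le.
  by rewrite -(leq_add2l (rk M (C :|: L1 :|: L2))); apply: leq_trans le modC.
(* With the empty set as common part, skewness leaves rank 0 for [None], against [rkN]. *)
have := rk_None_meet (spanC _ mod1) (spanC _ mod2) (sub0set C1) (sub0set C2).
rewrite imset0 setU0 rkN !NME => le.
by have := leq_trans le skew; rewrite addn1 ltnn.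
Qed.

End NotLifted.

(** * The cyclic ladder *)

Section Ladder.
Variable m : nat.
Local Notation n := m.+2.
Implicit Types (i j : 'I_n) (a b t : bool) (s : {ffun 'I_n -> bool}).

Definition ladder_vertex : finType := ('I_n * bool)%type.
(** The last component of an [inl] edge is the change of the bit, not the bit reached, so membership
    in [cycle_pair s] depends only on the layer and on this component. *)
Definition ladder_edge : finType := ('I_n * bool * bool + 'I_n * 'I_4)%type.

Definition ladder_ends (e : ladder_edge) : {set ladder_vertex} :=
  match e with
  | inl (i, a, t) => [set (i, a); (ordS i, a (+) t)]
  | inr (i, _) => [set (i, false); (i, true)]
  end.

Fact ladder_ends_card e : 1 <= #|ladder_ends e| <= 2.
Proof. by case: e => [[[i a] t]|[i k]]; rewrite cards2; case: (_ != _). Qed.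

Definition ladder : graph ladder_vertex ladder_edge := Graph ladder_ends_card.

Definition rungs i : {set ladder_edge} := [set inr (i, k) | k : 'I_4].

Definition pair_cycle s b : {set ladder_edge} :=
  [set e : ladder_edge | if e is inl (i, a, t)
     then (t == s i (+) s (ordS i)) && (a == s i (+) b) else false].

Definition cycle_pair s : {set ladder_edge} :=
  [set e : ladder_edge | if e is inl (i, _, t)
     then t == s i (+) s (ordS i) else false].

Definition pair_side s b : {set ladder_vertex} := [set v | v.2 == s v.1 (+) b].

Lemma cycle_pairE s : cycle_pair s = pair_cycle s false :|: pair_cycle s true.
Proof.
apply/setP => -[[[i a] t]|[i k]]; rewrite !inE //= -andb_orr.
by rewrite addbF addbT; case: a (s i) => -[]; rewrite ?andbT.
Qed.

Lemma pair_cycle_imset s b :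
  pair_cycle s b = [set inl (i, s i (+) b, s i (+) s (ordS i)) | i : 'I_n].
Proof.
apply/setP => -[[[i a] t]|[i k]]; rewrite inE; last by apply/esym/imsetP => -[].
apply/andP/imsetP => [[/eqP-> /eqP->]|[j _ [-> -> ->]]]; last by rewrite !eqxx.
by exists i.
Qed.

Lemma card_pair_cycle s b : #|pair_cycle s b| = n.
Proof. by rewrite pair_cycle_imset card_imset ?card_ord // => i j []. Qed.

Lemma pair_cycle_cycle s b : cycle_edges ladder (pair_cycle s b).
Proof.
exists m.+1, (fun i => (i, s i (+) b)).
exists (fun i => inl (i, s i (+) b, s i (+) s (ordS i))).
split; [by move=> i j [] | by move=> i j [] | | exact: pair_cycle_imset].
move=> i /=; congr [set _; (_, _)].
by case: (s i) (s (ordS i)) b => [] [] [].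
Qed.

Lemma pair_cycle_circuit s b : circuit (cycle_matroid ladder) (pair_cycle s b).
Proof. exact/circuit_cycle_matroid/pair_cycle_cycle. Qed.

Lemma grk_pair_cycle s b : grk ladder (pair_cycle s b) = m.+1.
Proof.
by have := rk_circuit (pair_cycle_circuit s b); rewrite card_pair_cycle => -[].
Qed.

Lemma pair_side_setC s : ~: pair_side s false = pair_side s true.
Proof.
by apply/setP => -[i a]; rewrite !inE addbF addbT; case: a (s i) => -[].
Qed.

Lemma pair_cycle_side s b f : f \in pair_cycle s b -> ends ladder f \subset pair_side s b.
Proof.
rewrite pair_cycle_imset => /imsetP[i _ ->] /=.
rewrite subUset !sub1set !inE eqxx /=.
by case: (s i) (s (ordS i)) b => [] [] [].
Qed.

Lemma cycle_pair_side s f : f \in cycle_pair s ->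
  (ends ladder f \subset pair_side s false)
  || (ends ladder f \subset ~: pair_side s false).
Proof.
rewrite pair_side_setC cycle_pairE.
by case/setUP => /pair_cycle_side ->; rewrite ?orbT.
Qed.

Lemma grk_pair_cycle_split s (A0 A1 : {set ladder_edge}) :
  A0 \subset pair_cycle s false -> A1 \subset pair_cycle s true ->
  grk ladder (A0 :|: A1) = grk ladder A0 + grk ladder A1.
Proof.
move=> /subsetP sA0 /subsetP sA1; apply: (@grk_disjoint _ _ _ (pair_side s false)).
  by move=> f /sA0 /pair_cycle_side.
by move=> f /sA1 /pair_cycle_side; rewrite pair_side_setC.
Qed.

Lemma pair_cycle_disjoint s : pair_cycle s false :&: pair_cycle s true = set0.
Proof.
apply/setP => -[[[i a] t]|[i k]]; rewrite !inE //.
by rewrite addbF addbT; case: a (s i) => -[]; rewrite ?andbF.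
Qed.

Lemma card_cycle_pair s : #|cycle_pair s| = n.*2.
Proof.
by rewrite cycle_pairE cardsU pair_cycle_disjoint cards0 subn0 !card_pair_cycle addnn.
Qed.

Lemma grk_cycle_pair s : grk ladder (cycle_pair s) = m.+1.*2.
Proof. by rewrite cycle_pairE (@grk_pair_cycle_split s) // !grk_pair_cycle addnn. Qed.

(** Converse to [cycle_pair_side]: a rung always joins the two sides, and a layer edge changes side
    unless its bit change agrees with that of [s]. *)
Lemma cycle_pair_crossing s g : g \notin cycle_pair s -> exists u v,
  [/\ ends ladder g = [set u; v], u \in pair_side s false & v \notin pair_side s false].
Proof.
case: g => [[[i a] t]|[i k]]; rewrite inE => nX.
  have [ai|ai] := boolP (a == s i).
    exists (i, a), (ordS i, a (+) t); rewrite !inE !addbF; split=> //=.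
    by rewrite (eqP ai); move: nX; case: (s i) (s (ordS i)) t => [] [] [].
  exists (ordS i, a (+) t), (i, a); rewrite !inE !addbF setUC; split=> //=.
  by move: ai nX; case: (s i) (s (ordS i)) t a => [] [] [] [].
case: (boolP (s i)) => si.
  by exists (i, true), (i, false); rewrite !inE /= si setUC.
by exists (i, false), (i, true); rewrite !inE /= (negPf si).
Qed.

Lemma grk_cycle_pair_add s g : g \notin cycle_pair s ->
  grk ladder (g |: cycle_pair s) = (m.+1.*2).+1.
Proof.
move=> /cycle_pair_crossing[u [v [Eg uS vS]]].
by rewrite (grk_cut Eg uS vS) ?grk_cycle_pair // => f /cycle_pair_side.
Qed.

Lemma grk_ladder A : grk ladder A < n.*2.
Proof.
apply: (@leq_ltn_trans (grk ladder (edges_in ladder setT))).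
  by apply: grk_mono; apply/subsetP => e _; rewrite inE subsetT.
apply: leq_trans (grk_edges_in _ (in_setT (ord0, false))) _.
by rewrite cardsT card_prod card_ord card_bool muln2.
Qed.

(** * The lift, its circuit-hyperplanes and their relaxations *)

Definition ladder_lift := free_lift (cycle_matroid ladder).

Lemma ladder_lift_lifted_graphic : lifted_graphic ladder_lift.
Proof.
apply: free_lift_lifted_graphic; exists ladder_vertex, ladder => C.
exact: circuit_cycle_matroid.
Qed.

Lemma rk_lift_cycle_pair s : rk ladder_lift (cycle_pair s) = (m.+1.*2).+1.
Proof.
by rewrite /= /free_lift_rk card_cycle_pair /= grk_cycle_pair; apply/minn_idPr.
Qed.

Lemma cycle_pair_dep s : rk ladder_lift (cycle_pair s) < #|cycle_pair s|.
Proof. by rewrite rk_lift_cycle_pair card_cycle_pair. Qed.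

(** The missing edge breaks one of the two cycles, so that part of [A] is a forest; the other part
    has nullity at most one, which the lift allows. *)
Lemma cycle_pair_min s (A : {set ladder_edge}) :
  A \proper cycle_pair s -> rk ladder_lift A = #|A|.
Proof.
move=> /properP[sA [e eX eA]]; apply/minn_idPl => /=.
pose A0 := A :&: pair_cycle s false; pose A1 := A :&: pair_cycle s true.
have AE : A = A0 :|: A1 by rewrite -setIUr -cycle_pairE (setIidPl sA).
have cA : #|A| = #|A0| + #|A1|.
  by rewrite {1}AE cardsU setIACA pair_cycle_disjoint setI0 cards0 subn0.
rewrite cA AE (@grk_pair_cycle_split s) ?subsetIr //.
have leA b := rk_circuit_sub (pair_cycle_circuit s b) (subsetIr A _).
have eqA b : e \in pair_cycle s b ->
    grk ladder (A :&: pair_cycle s b) = #|A :&: pair_cycle s b|.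
  move=> eb; have [_ minb] := pair_cycle_circuit s b.
  apply/eqP/minb; rewrite properE subsetIr /=.
  by apply: contra eA => /subsetP/(_ _ eb); rewrite inE => /andP[].
move: eX; rewrite cycle_pairE => /setUP[] /eqA eqb; rewrite eqb.
  by rewrite -addnS leq_add2l leA.
by rewrite -addSn leq_add2r leA.
Qed.

(** A further edge joins the two cycles, so [A] has the full rank 2n - 1 in the ladder and 2n in the
    lift. *)
Lemma cycle_pair_max s (A : {set ladder_edge}) :
  cycle_pair s \proper A -> rk ladder_lift A = (rk ladder_lift (cycle_pair s)).+1.
Proof.
move=> pA; have /properP[sXA [g gA gX]] := pA.
rewrite rk_lift_cycle_pair /= /free_lift_rk; apply/eqP; rewrite eqn_leq.
apply/andP; split; first by apply: leq_trans (geq_minr _ _) _; apply: grk_ladder.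
rewrite leq_min; apply/andP; split.
  by have := subset_leq_card sXA; rewrite card_cycle_pair.
rewrite ltnS -(grk_cycle_pair_add gX); apply: grk_mono.
by rewrite subUset sub1set gA.
Qed.

Definition ladder_relax s : matroid ladder_edge :=
  relax (@cycle_pair_dep s) (@cycle_pair_min s) (@cycle_pair_max s).

Lemma ladder_relaxE s A : A != cycle_pair s ->
  rk (ladder_relax s) A = rk ladder_lift A.
Proof. by move=> /negPf nA; rewrite /= /relax_rk nA addn0. Qed.

Lemma inr_cycle_pair s x : inr x \notin cycle_pair s.
Proof. by case: x => i k; rewrite inE. Qed.

Lemma neq_cycle_pair s x (A : {set ladder_edge}) : inr x \in A -> A != cycle_pair s.
Proof. by move=> xA; apply: contraNneq (inr_cycle_pair s x) => <-. Qed.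

(** A component contains both ends of a rung, so its edge set is not the relaxed one, and lifting
    adds at most 1 to a graph rank below [#|W|]. For the closure condition, a non-loop edge at [v]
    crosses the cut around [v]. *)
Lemma ladder_relax_framework s : framework ladder (ladder_relax s).
Proof.
split=> [W /imsetP[[i a] _ WE]|v].
  have iW b : (i, b) \in W.
    rewrite WE inE; have [->|nba] := eqVneq b a; first exact: connect0.
    apply/connect1/existsP; exists (inr (i, ord0)) => /=.
    by case: a b nba {WE} => [] []; rewrite // setUC.
  rewrite (@ladder_relaxE _ _ (neq_cycle_pair (x := (i, ord0)) _ _)).
    apply: leq_trans (geq_minr _ _) _; exact: grk_edges_in (iW true).
  by rewrite inE /= subUset !sub1set !iW.
apply/subsetP => e; rewrite !inE; apply: contraTT.
rewrite negb_or negbK => /andP[ve nloop].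
have [u [w Ee]] := ends_pair ladder e.
have {u w Ee} [w Ee nwv] : exists2 w, ends ladder e = [set v; w] & w != v.
  move: ve nloop; rewrite Ee !inE => /orP[]/eqP->.
    exists w => //; apply: contraNneq nloop => ->.
    by rewrite setUid.
  exists u; first by rewrite setUC.
  by apply: contraNneq nloop => ->; rewrite setUid.
set A := edges_minus ladder v.
have eA : e \notin A by rewrite inE negbK.
have grkA : grk ladder (e |: A) = (grk ladder A).+1.
  apply: (grk_cut (S := [set v]) Ee); rewrite ?inE // => f; rewrite inE => vf.
  by apply/orP; right; rewrite subsetC sub1set inE.
(* Adding [e] raises both terms of the minimum. *)
have liftA : rk ladder_lift (e |: A) = (rk ladder_lift A).+1.
  by rewrite /= /free_lift_rk cardsU1 eA /= grkA add1n minnSS.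
(* The two cycles cover every vertex, whereas [A] has no edge at [v]. *)
have nAX : A != cycle_pair s.
  apply/eqP => /setP/(_ (inl (v.1, v.2, s v.1 (+) s (ordS v.1)))).
  by rewrite !inE /= -surjective_pairing !eqxx.
rewrite (ladder_relaxE nAX) neq_ltn; apply/orP; right.
by rewrite -liftA /= /relax_rk leq_addr.
Qed.

(** * Rungs as lines, and the failure of being lifted-graphic *)

Lemma rungs_line i : rungs i \subset edges_in ladder [set (i, false); (i, true)].
Proof. by apply/subsetP => _ /imsetP[k _ ->]; rewrite inE. Qed.

Lemma grk_rungs i : grk ladder (rungs i) <= 1.
Proof.
apply: leq_trans (grk_mono _ (rungs_line i)) _; rewrite -ltnS.
apply: leq_trans (grk_edges_in _ _) _; first exact: set21.
by rewrite cards2; case: (_ != _).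
Qed.

(** Four parallel edges have graph rank 1, so the lift gives a subset the rank min([#|A|], 2); no
    subset is the relaxed set, which contains layer edges. *)
Lemma four_point_line_rungs s i : four_point_line (ladder_relax s) (rungs i).
Proof.
pose r (k : nat) (lt4 : k < 4) : ladder_edge := inr (i, Ordinal lt4).
exists (r 0 isT), (r 1 isT), (r 2 isT), (r 3 isT); split=> [||A sA].
- have r_inj : injective (fun k : 'I_4 => inr (i, k) : ladder_edge).
    by move=> k l [].
  exact: etrans (map_inj_uniq r_inj [:: Ordinal (isT : 0 < 4);
    Ordinal (isT : 1 < 4); Ordinal (isT : 2 < 4); Ordinal (isT : 3 < 4)]) _.
- apply/setP => e; rewrite !inE; apply/imsetP/idP => [[[k lt4] _ ->]|].
    by move: k lt4 => [|[|[|[|//]]]] lt4; rewrite /r (bool_irrelevance lt4 isT) eqxx ?orbT.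
  by rewrite -!orbA => /or4P[]/eqP->; eexists.
have nA : A != cycle_pair s.
  apply: contraTneq sA => ->; apply/subsetPn.
  exists (inl (i, true, s i (+) s (ordS i))); first by rewrite inE.
  by apply/imsetP => -[].
rewrite ladder_relaxE //= /free_lift_rk /=.
have [->|/set0Pn[g gA]] := eqVneq A set0; first by rewrite cards0 !min0n.
suff -> : grk ladder A = 1 by [].
apply/eqP; rewrite eqn_leq (leq_trans (grk_mono _ sA) (grk_rungs i)) /=.
have /imsetP[k _ gE] := subsetP sA _ gA.
have <- : grk ladder [set g] = 1.
  rewrite -[[set g]]setU0.
  rewrite (@grk_cut _ _ _ [set (i, false)] _ _ (i, false) (i, true));
    rewrite ?gE ?inE ?xpair_eqE ?eqxx ?andbF //.
    by congr _.+1; apply/eqP; rewrite -leqn0 -(cards0 ladder_edge) grk_card.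
  by move=> f; rewrite inE.
by apply: grk_mono; rewrite sub1set.
Qed.

(** No edge of [X] meets the end of the new rung that lies off the cycle, so the cut around that
    vertex applies. *)
Lemma grk_add_rung s b j (X : {set ladder_edge}) :
    (forall f, f \in X -> f \in pair_cycle s b \/ exists2 i, i != j & f \in rungs i) ->
  grk ladder (inr (j, ord0) |: X) = (grk ladder X).+1.
Proof.
move=> XP; pose c := s j (+) b.
have Ee : ends ladder (inr (j, ord0)) = [set (j, ~~ c); (j, c)].
  by case: c => //=; rewrite setUC.
apply: (grk_cut (S := [set (j, ~~ c)]) Ee).
- by rewrite inE.
- by rewrite inE xpair_eqE eqxx /=; case: (c).
move=> f /XP[/pair_cycle_side sf|[i nij /imsetP[k _ ->]]].
  apply/orP; right; apply: subset_trans sf _; rewrite subsetC.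
  by rewrite sub1set !inE /= /c; case: (_ (+) _).
by apply/orP; right; rewrite /= subUset !sub1set !inE !xpair_eqE (negPf nij).
Qed.

(** The cycle has rank at least n, adding one layer of rungs gives at most n + 1, and adding two
    layers gives at least n + 2. *)
Lemma pair_cycle_lines s b i j : i != j ->
  rk (ladder_relax s) (pair_cycle s b :|: rungs i)
    + rk (ladder_relax s) (pair_cycle s b :|: rungs j)
  <= rk (ladder_relax s) (pair_cycle s b :|: rungs i :|: rungs j)
    + rk (ladder_relax s) (pair_cycle s b).
Proof.
move=> nij; set C := pair_cycle s b.
have rung k : inr (k, ord0) \in rungs k by apply: imset_f.
have le1 k : rk (ladder_relax s) (C :|: rungs k) <= n.+1.
  rewrite (@ladder_relaxE _ _ (neq_cycle_pair (x := (k, ord0)) _ _)); last first.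
    by rewrite inE rung orbT.
  apply: leq_trans (geq_minr _ _) _; rewrite ltnS.
  apply: leq_trans (rk_setU (cycle_matroid ladder) _ _) _.
  by rewrite /= grk_pair_cycle -[n]addn1 leq_add2l grk_rungs.
have geC : n <= rk (ladder_relax s) C.
  apply: leq_trans (leq_addr _ _).
  by rewrite /= /free_lift_rk card_pair_cycle /= grk_pair_cycle minnn.
have geU : n.+2 <= rk (ladder_relax s) (C :|: rungs i :|: rungs j).
  apply: leq_trans (leq_addr _ _).
  rewrite /= leq_min; apply/andP; split.
    (* For the cardinality term of the minimum, the cycle and one layer of rungs already give n + 4
       elements. *)
    apply: (@leq_trans #|C :|: rungs i|); last exact/subset_leq_card/subsetUl.
    have -> : #|C :|: rungs i| = n + 4.
      rewrite cardsU card_pair_cycle card_imset ?card_ord; last by move=> x y [].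
      rewrite (_ : _ :&: _ = set0) ?cards0 ?subn0 //.
      apply/setP => e; rewrite !inE; apply/negP => /andP[eC /imsetP[k _ eE]].
      by rewrite eE in eC.
    by rewrite -addn2 leq_add2l.
  rewrite ltnS /=; apply: (@leq_trans (grk ladder (inr (j, ord0) |: (inr (i, ord0) |: C)))).
    rewrite (@grk_add_rung s b) ?(@grk_add_rung s b) ?grk_pair_cycle //.
      by move=> f fC; left.
    by move=> f /setU1P[->|fC]; [right; exists i | left].
  apply: grk_mono; rewrite !subUset !sub1set !inE !rung !orbT /=.
  by rewrite -setUA subsetUl.
by apply: leq_trans (leq_add (le1 i) (le1 j)) _; rewrite -(addSnnS n.+1 n) leq_add.
Qed.

Lemma ladder_relax_not_lifted_graphic s : ~ lifted_graphic (ladder_relax s).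
Proof.
apply: (@skew_not_lifted_graphic _ _ (rungs ord0) (rungs ord_max)
          (pair_cycle s false) (pair_cycle s true)).
- exact: four_point_line_rungs.
- exact: four_point_line_rungs.
(* The layers [ord0] and [ord_max] differ because n is [m.+2]. *)
- exact: pair_cycle_lines.
- exact: pair_cycle_lines.
(* Skewness: relaxation brings the rank of the pair to 2n, the total size of the two cycles. *)
rewrite -cycle_pairE [leqRHS]/= /relax_rk eqxx rk_lift_cycle_pair addn1.
apply: leq_trans (leq_add (rk_card _ _) (rk_card _ _)) _.
by rewrite !card_pair_cycle addnn doubleS.
Qed.

(** The pair determines the changes of [s] between consecutive layers, hence [s] up to complement;
    the value at [ord0] settles the rest. *)
Lemma cycle_pair_inj :
  injective (fun s => (cycle_pair s, s ord0)).
Proof.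
move=> s s' [eqX eq0]; have step i : s i (+) s (ordS i) = s' i (+) s' (ordS i).
  have /setP/(_ (inl (i, false, s i (+) s (ordS i)))) := eqX.
  by rewrite !inE eqxx => /esym/eqP.
apply/ffunP => i; apply/eqP; rewrite -negb_add.
have inv h : s (ordS h) (+) s' (ordS h) = s h (+) s' h.
  move: (step h).
  by case: (s h) (s (ordS h)) (s' h) (s' (ordS h)) => [] [] [] [].
rewrite (@ordS_invariant _ (fun h => s h (+) s' h) i ord0) //.
by rewrite eq0 addbb.
Qed.

(** The doubling accounts for [s] and its complement giving the same pair. *)
Lemma exists_cycle_pair_notin (A : {set {set ladder_edge}}) :
  #|A|.*2 < 2 ^ n -> exists s, cycle_pair s \notin A.
Proof.
move=> ltA; apply/existsP; apply: contraLR ltA => /existsPn allA.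
have: [set (cycle_pair s, s ord0) | s : {ffun 'I_n -> bool}]
    \subset setX A [set: bool].
  apply/subsetP => _ /imsetP[s _ ->].
  by rewrite !inE /= andbT -[_ \in A]negbK allA.
move/subset_leq_card; rewrite (card_imset _ cycle_pair_inj) cardsX cardsT.
by rewrite card_bool card_ffun card_bool card_ord muln2 leqNgt.
Qed.

Lemma card_ladder_edge : #|{: ladder_edge}| = 8 * n.
Proof. by rewrite card_sum !card_prod !card_ord card_bool -mulnA -mulnDr mulnC. Qed.

End Ladder.

(** * Powers of two outgrow polynomials *)

Lemma linear_lt_exp2 a b : exists2 k, 0 < k & a + b * k < 2 ^ k.
Proof.
(* With k = 2j, the power 2^k is the square of 2^j, hence at least j * j, and [j] is chosen so that
   j * j already exceeds the linear term. *)
pose j := (a + b.*2).+1; exists j.*2 => //.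
rewrite -[in ltnRHS]addnn expnD; apply: (@leq_trans (j * j)); last first.
  by apply: leq_mul; apply/ltnW/ltn_expl.
have -> : j * j = j + (a * j + b.*2 * j) by rewrite {1}/j mulSn mulnDl.
rewrite -doubleMr doubleMl addnA ltn_add2r.
by apply: (@leq_trans j); rewrite ?leq_addr // ltnS leq_addr.
Qed.

Local Open Scope ring_scope.

Lemma horner_norm_bound (R : realDomainType) (p : {poly R}) (x : R) : 1 <= x ->
  `|p.[x]| <= (\sum_(i < size p) `|p`_i|) * x ^+ size p.
Proof.
move=> x1; rewrite horner_coef mulr_suml; apply: le_trans (ler_norm_sum _ _ _) _.
apply: ler_sum => i _; rewrite normrM ler_wpM2l // normrX ger0_norm.
  by rewrite ler_weXn2l // ltnW.
exact: le_trans x1.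
Qed.

(** The argument takes n = 2^k. If the coefficient sum is at most 2^N, then twice the value at c n
    is at most 2 to the power N + c d + 1 + d k, linear in k, whereas the target exponent is 2^k. *)
Lemma poly_lt_exp2 (R : archiRealFieldType) (p : {poly R}) (c : nat) :
  (0 < c)%N -> exists m, p.[(c * m.+2)%:R] *+ 2 < 2 ^+ m.+2.
Proof.
move=> c0; pose C := \sum_(i < size p) `|p`_i|; pose d := size p.
have ltn2 k : (k%:R : R) <= 2 ^+ k by rewrite -natrX ler_nat ltnW // ltn_expl.
have [N CN] : exists N, C <= 2 ^+ N.
  exists (Num.bound C); apply: le_trans (ltn2 _); apply/ltW/archi_boundP.
  exact: sumr_ge0.
have [k k0 ltk] := linear_lt_exp2 (N + c * d).+1 d.
have /subnK nE : (2 <= 2 ^ k)%N by rewrite -{1}[2%N]expn1 leq_exp2l.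
exists (2 ^ k - 2)%N; rewrite -addn2 nE.
have x1 : 1 <= (c * 2 ^ k)%:R :> R by rewrite ler1n muln_gt0 c0 expn_gt0.
apply: le_lt_trans (_ : 2 ^+ ((N + c * d).+1 + d * k) < _); last first.
  by rewrite ltr_eXn2l // ltr1n.
apply: (@le_trans _ _ (`|p.[(c * 2 ^ k)%:R]| *+ 2)).
  by rewrite lerMn2r /= ler_norm.
rewrite addSn exprS mulr_natl lerMn2r /=; apply: le_trans (horner_norm_bound _ x1) _.
rewrite -addnA exprD ler_pM ?sumr_ge0 ?exprn_ge0 ?ler0n //.
rewrite [(d * k)%N]mulnC -mulnDl exprM lerXn2r ?nnegrE ?exprn_ge0 ?ler0n //.
by rewrite exprD natrM natrX ler_wpM2r ?exprn_ge0.
Qed.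

Theorem theorem3p2 (R : realType) (p : {poly R}) :
  exists (E : finType) (M : matroid E),
    lifted_graphic M /\
    forall A : {set {set E}},
      #|A|%:R <= p.[#|E|%:R] ->
      exists M' : matroid E,
        [/\ quasi_graphic M',
            ~ lifted_graphic M'
          & forall X : {set E}, X \in A -> rk M' X = rk M X].
Proof.
(* The ladder has 8 edges per layer: four to the next layer and four rungs. *)
have [m ltp] := poly_lt_exp2 p (isT : 0 < 8)%N.
exists (ladder_edge m), (ladder_lift m); split.
  exact: ladder_lift_lifted_graphic.
move=> A leA.
have [|s sA] := @exists_cycle_pair_notin m A.
  rewrite -(ltr_nat R) natrX -muln2 natrM mulr_natr.
  by apply: le_lt_trans ltp; rewrite -card_ladder_edge lerMn2r.
exists (ladder_relax s); split.
- by exists (ladder_vertex m), (ladder m); apply: ladder_relax_framework.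
- exact: ladder_relax_not_lifted_graphic.
- by move=> X XA; apply: ladder_relaxE; apply: contraNneq sA => <-.
Qed.
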